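(* Let $\mu:\mathbb{C}\langle X,Y\rangle\to\mathbb{C}$ be a unital linear functional with respect to which $X$ and $Y$ are free. Then for every non-commutative polynomial $P\in\mathbb{C}\langle X,Y\rangle$ $$\mathbb{E}_X[P]=\beta^b_Y(P)+(\beta^b_Y\otimes\mathbb{E}_X)\bigl(\vec\delta_X(P)\bigr).$$
   Context: $\mathbb{C}\langle X,Y\rangle$ is the free unital associative algebra. $X$ and $Y$ are free with respect to $\mu$ if $\mu(u_1\cdots u_n)=0$ whenever $n\ge1$, $\mu(u_j)=0$ for all $j$, and the $u_j$ are taken alternatingly from $\mathbb{C}[X]$ and $\mathbb{C}[Y]$. Boolean cumulants of $\mu$: the multilinear functionals $\beta_n$ on $\mathbb{C}\langle X,Y\rangle$ determined by $\mu(a_1\cdots a_n)=\sum_{k=1}^n\beta_k(a_1,\dots,a_k)\mu(a_{k+1}\cdots a_n)$ (empty product $=1$). Block cumulant functional: $\beta^b_Y:\mathbb{C}\langle X,Y\rangle\to\mathbb{C}$ is the linear functional with $\beta^b_Y(1)=1$; $\beta^b_Y(a_1b_1a_2\cdots b_{n-1}a_n)=\beta_{2n-1}(a_1,b_1,a_2,\dots,b_{n-1},a_n)$ if $a_i\in\{Y^k:k\ge1\}$ and $b_i\in\{X^k:k\ge1\}$; and $\beta^b_Y(w)=0$ for every other monomial $w$ (i.e. a non-empty word that starts or ends with $X$). Formal conditional expectation: $\mathbb{E}_X:\mathbb{C}\langle X,Y\rangle\to\mathbb{C}[X]$ is the linear map with $\mathbb{E}_X[1]=1$, $\mathbb{E}_X[bwb']=b\,\mathbb{E}_X[w]\,b'$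 for $b,b'\in\mathbb{C}[X]$, and for $a_i\in\{Y^k:k\ge1\}$, $b_i\in\{X^k:k\ge1\}$, $$\mathbb{E}_X[a_1b_1a_2\cdots b_{n-1}a_n]=\sum_{k=0}^{n-1}\ \sum_{1\le i_1<\dots<i_k\le n-1} b_{i_1}\cdots b_{i_k}\prod_{j=0}^{k}\beta_{2(i_{j+1}-i_j)-1}(a_{i_j+1},b_{i_j+1},a_{i_j+2},\dots,a_{i_{j+1}}),$$ with $i_0=0$, $i_{k+1}=n$. Derivation: $\vec\delta_X:\mathbb{C}\langle X,Y\rangle\to\mathbb{C}\langle X,Y\rangle\otimes\mathbb{C}\langle X,Y\rangle$ is the linear map given on words $w=w_1\cdots w_n$ (letters $w_j\in\{X,Y\}$) by $\vec\delta_X(w)=\sum_{j:\,w_j=X}w_1\cdots w_{j-1}\otimes w_jw_{j+1}\cdots w_n$ (so $\vec\delta_X(1)=0$). The map $\beta_Y^b\otimes\mathbb{E}_X$ sends $u\otimes v$ to $\beta^b_Y(u)\,\mathbb{E}_X[v]$. *)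

(* Defs.v *)
From HB Require Import structures.
From mathcomp Require Import all_boot all_order all_algebra.
From mathcomp Require Import zify finmap complex reals.
From mathcomp.multinomials Require Import monalg.

Set Implicit Arguments.
Unset Strict Implicit.
Unset Printing Implicit Defensive.

Import GRing.Theory.
Local Open Scope ring_scope.

Notation letterX := false.
Notation letterY := true.

(* Words in X and Y: the free monoid on two letters. *)
Notation word := {fmonom bool}.

(* The monoid algebra of the free monoid, i.e. the free unital algebra. *)
Notation ncpoly R := {malg R[i][word]}.

(* The words form a basis of [ncpoly R], so the pairs of words form a basis of
   the tensor square: (u, v) stands for u (x) v. *)
Notation ncpoly2 R := {malg R[i][(word * word)%type]}.

Section Basics.
Variable R : realType.
Implicit Types (P Q : ncpoly R).

Definition mon (w : seq bool) : ncpoly R := << FMonom w >>.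
Definition var (c : bool) : ncpoly R := mon [:: c].

(* The image of C[X] (resp. C[Y]) in the free algebra. *)
Definition evalp (c : bool) (p : {poly R[i]}) : ncpoly R :=
  \sum_(i < size p) p`_i *: var c ^+ i.

(* The linear extension of a map given on a basis. *)
Definition linext (K : choiceType) (V : lmodType R[i]) (f : K -> V)
    (P : {malg R[i][K]}) : V :=
  \sum_(k <- msupp P) P@_k *: f k.

Definition tensor P Q : ncpoly2 R :=
  \sum_(u <- msupp P) \sum_(v <- msupp Q) << P@_u * Q@_v *g (u, v) >>.

Definition delta_X : ncpoly R -> ncpoly2 R :=
  linext (fun w : word =>
    \sum_(j < size w | nth letterY w j == letterX)
      tensor (mon (take j w)) (mon (drop j w))).

Definition tensor_map (V : lmodType R[i]) (f : ncpoly R -> R[i])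
    (g : ncpoly R -> V) : ncpoly2 R -> V :=
  linext (fun uv : (word * word)%type => f (mon uv.1) *: g (mon uv.2)).

Section Functional.
Variable mu : {scalar ncpoly R}.

Definition free_XY : Prop :=
  forall (n : nat) (c : bool) (p : nat -> {poly R[i]}), (0 < n)%N ->
    (forall j, (j < n)%N -> mu (evalp (c (+) odd j) (p j)) = 0) ->
  mu (\prod_(j < n) evalp (c (+) odd j) (p j)) = 0.

(* beta_n (a_1, ..., a_n) is [bcum [:: a_1; ...; a_n]]: the moment-cumulant
   relation [bcumP] solved for its term k = n. The first argument of [bcum_rec]
   only bounds the depth of the recursion. *)
Fixpoint bcum_rec (d : nat) (s : seq (ncpoly R)) : R[i] :=
  if d is d'.+1 then
    mu (\prod_(a <- s) a)
    - \sum_(1 <= k < size s)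
        bcum_rec d' (take k s) * mu (\prod_(a <- drop k s) a)
  else 0.

Definition bcum (s : seq (ncpoly R)) : R[i] := bcum_rec (size s) s.

(* The 2(q-p)-1 arguments a_(p+1), b_(p+1), a_(p+2), ..., b_(q-1), a_q. *)
Definition args (T : Type) (a b : nat -> T) (p q : nat) : seq T :=
  mkseq (fun m => (if odd m then b else a) (p + m./2).+1) (2 * (q - p) - 1).

(* [args] for a_i = Y^(k i) and b_i = X^(l i). *)
Definition args_YX (k l : nat -> nat) : nat -> nat -> seq (ncpoly R) :=
  args (fun i => var letterY ^+ k i) (fun i => var letterX ^+ l i).

Record is_block_cumulant (betaY : {scalar ncpoly R}) : Prop := {
  block_cumulant1 : betaY 1 = 1;
  block_cumulant_alt : forall (n : nat) (k l : nat -> nat), (0 < n)%N ->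
    (forall i, 0 < k i)%N -> (forall i, 0 < l i)%N ->
    betaY (\prod_(x <- args_YX k l 0 n) x) = bcum (args_YX k l 0 n);
  block_cumulantXl : forall w : seq bool, betaY (mon (letterX :: w)) = 0;
  block_cumulantXr : forall w : seq bool, betaY (mon (rcons w letterX)) = 0
}.

(* The tuple i ranges over the sequences 0 < i_1 < ... < i_r < n, and [idx j]
   is i_j with the conventions i_0 = 0 and i_(r+1) = n. *)
Definition cond_exp_sum (n : nat) (k l : nat -> nat) : {poly R[i]} :=
  \sum_(r < n) \sum_(i : r.-tuple 'I_n | path ltn 0%N (map val i))
    let idx := nth n (0%N :: map val i) in
    (\prod_(j <- i) 'X^(l j))
    * (\prod_(j < r.+1) bcum (args_YX k l (idx j) (idx j.+1)))%:P.

Record is_cond_exp (EX : {linear ncpoly R -> {poly R[i]}}) : Prop := {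
  cond_exp1 : EX 1 = 1;
  cond_exp_bimod : forall (b b' : {poly R[i]}) (P : ncpoly R),
    EX (evalp letterX b * P * evalp letterX b') = b * EX P * b';
  cond_exp_alt : forall (n : nat) (k l : nat -> nat), (0 < n)%N ->
    (forall i, 0 < k i)%N -> (forall i, 0 < l i)%N ->
    EX (\prod_(x <- args_YX k l 0 n) x) = cond_exp_sum n k l
}.

End Functional.
End Basics.

Section Facts.
Variable R : realType.
Implicit Types (P Q : ncpoly R).

Lemma linextEw (K : choiceType) (V : lmodType R[i]) (f : K -> V)
    (P : {malg R[i][K]}) (d : {fset K}) :
  (msupp P `<=` d)%fset -> linext f P = \sum_(k <- d) P@_k *: f k.
Proof.
move=> le; rewrite /linext (big_fset_incl _ le) //= => k _ kP.
by rewrite mcoeff_outdom // scale0r.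
Qed.

Lemma linext_is_linear (K : choiceType) (V : lmodType R[i]) (f : K -> V) :
  linear (linext f).
Proof.
move=> c P Q.
pose d := (msupp P `|` msupp Q)%fset.
have leP : (msupp P `<=` d)%fset by apply: fsubsetUl.
have leQ : (msupp Q `<=` d)%fset by apply: fsubsetUr.
have le : (msupp (c *: P + Q) `<=` d)%fset.
  apply: fsubset_trans (msuppD_le _ _) _.
  by rewrite fsubUset leQ andbT (fsubset_trans (msuppZ_le _ _)).
rewrite (linextEw _ leP) (linextEw _ leQ) (linextEw _ le) scaler_sumr -big_split.
by apply: eq_bigr => k _; rewrite mcoeffD mcoeffZ scalerDl scalerA.
Qed.

HB.instance Definition _ (K : choiceType) (V : lmodType R[i]) (f : K -> V) :=
  GRing.isLinear.Build R[i] {malg R[i][K]} V *:%R (linext f)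
    (linext_is_linear f).

Lemma linextU (K : choiceType) (V : lmodType R[i]) (f : K -> V) (k : K) :
  linext f << k >> = f k.
Proof. by rewrite (linextEw _ msuppU_le) big_seq_fset1 mcoeffUU scale1r. Qed.

Lemma linext_scaleU (K : choiceType) (V : lmodType R[i]) (f : K -> V) c (k : K) :
  linext f << c *g k >> = c *: f k.
Proof. by rewrite (linextEw _ msuppU_le) big_seq_fset1 mcoeffUU. Qed.

Lemma monalg_scale (K : choiceType) c (k : K) :
  << c *g k >> = c *: << k >> :> {malg R[i][K]}.
Proof. by apply/malgP => x; rewrite mcoeffZ !mcoeffU mulr_natr. Qed.

Lemma malg_linE (V : lmodType R[i]) (s : GRing.Scale.law R[i] V)
    (f : {linear ncpoly R -> V | s}) P :
  f P = \sum_(k <- msupp P) s P@_k (f (mon R k)).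
Proof.
rewrite [in LHS](monalgE P) raddf_sum /=; apply: eq_bigr => k _.
by rewrite monalg_scale linearZ /mon fmK.
Qed.

Lemma tensor_mapE (V : lmodType R[i]) (f : {scalar ncpoly R})
    (g : {linear ncpoly R -> V}) P Q :
  tensor_map f g (tensor P Q) = f P *: g Q.
Proof.
rewrite (malg_linE f) (malg_linE g) scaler_suml /tensor_map linear_sum /=.
apply: eq_bigr => u _; rewrite linear_sum scaler_sumr /=.
apply: eq_bigr => v _.
by rewrite linext_scaleU /= !scalerA mulrAC.
Qed.

Lemma monM (s t : seq bool) : mon R s * mon R t = mon R (s ++ t).
Proof.
rewrite /mon malgM_def /= fgmulUU mulr1; congr << _ *g _ >>.
by apply/val_inj; rewrite /= fmM.
Qed.

Lemma mon1 : mon R [::] = 1.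
Proof. by rewrite /mon; congr << _ *g _ >>; apply/val_inj; rewrite /= fm1. Qed.

Lemma varX (c : bool) n : var R c ^+ n = mon R (nseq n c).
Proof.
elim: n => [|n IH]; first by rewrite expr0 mon1.
by rewrite exprS IH monM.
Qed.

Variable mu : {scalar ncpoly R}.

Lemma bcum_recE d (s : seq (ncpoly R)) :
  (size s <= d)%N -> (0 < size s)%N -> bcum_rec mu d s = bcum mu s.
Proof.
rewrite /bcum; move: {2}(size s) (leqnn (size s)) => m.
elim: m d s => [|m IH] d s sm sd s0; first by case: (size s) sm s0.
case: d sd => [|d sd]; first by case: (size s) s0.
case E: (size s) s0 => [|e] // _ /=; rewrite E; congr (_ - _).
apply: eq_big_nat => k /andP[k0 ke].
have sk : size (take k s) = k by rewrite size_takel // E ltnW.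
by rewrite !IH ?sk //; move: sm sd; rewrite E; lia.
Qed.

Lemma bcumE (s : seq (ncpoly R)) : (0 < size s)%N ->
  bcum mu s = mu (\prod_(a <- s) a)
    - \sum_(1 <= k < size s) bcum mu (take k s) * mu (\prod_(a <- drop k s) a).
Proof.
rewrite {1}/bcum; case E: (size s) => [|e] // _ /=; rewrite E; congr (_ - _).
apply: eq_big_nat => k /andP[k0 ke].
have sk : size (take k s) = k by rewrite size_takel // E ltnW.
by rewrite bcum_recE ?sk // -ltnS.
Qed.

(* The moment-cumulant relation; it determines the Boolean cumulants. *)
Lemma bcumP (s : seq (ncpoly R)) : mu 1 = 1 -> (0 < size s)%N ->
  mu (\prod_(a <- s) a) =
    \sum_(1 <= k < (size s).+1) bcum mu (take k s) * mu (\prod_(a <- drop k s) a).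
Proof.
move=> mu1 s0; rewrite big_nat_recr //= take_size drop_size big_nil mu1 mulr1.
by rewrite [bcum mu s]bcumE // addrC subrK.
Qed.

Lemma bcum_uniq (beta : seq (ncpoly R) -> R[i]) : mu 1 = 1 ->
  (forall s, (0 < size s)%N -> mu (\prod_(a <- s) a) =
     \sum_(1 <= k < (size s).+1) beta (take k s) * mu (\prod_(a <- drop k s) a)) ->
  forall s, (0 < size s)%N -> beta s = bcum mu s.
Proof.
move=> mu1 betaE s; move: {2}(size s) (leqnn (size s)) => m.
elim: m s => [|m IH] s sm s0; first by case: (size s) sm s0.
have := bcumP mu1 s0; rewrite betaE // !big_nat_recr //=.
rewrite take_size drop_size big_nil mu1 !mulr1.
rewrite (eq_big_nat _ _ (F2 := fun k =>
  bcum mu (take k s) * mu (\prod_(a <- drop k s) a))); first by move/addrI.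
move=> k /andP[k0 ks]; have sk : size (take k s) = k by rewrite size_takel // ltnW.
by rewrite IH ?sk // -ltnS (leq_trans ks).
Qed.

Lemma ncpoly_scaleAr (c : R[i]) P Q : P * (c *: Q) = c *: (P * Q).
Proof.
suff comC : P * c%:MP = c%:MP * P by rewrite -mul_malgC mulrA comC -mulrA mul_malgC.
rewrite mul_malgC malgM_def /= fgmulgU malgZ_def /fgscale.
by apply: eq_bigr => k _; rewrite mulm1 mulrC.
Qed.

Lemma ncpoly_scaleAl (c : R[i]) P Q : (c *: P) * Q = c *: (P * Q).
Proof. by rewrite scalerAl. Qed.

Lemma bcum_multilinear (s1 s2 : seq (ncpoly R)) (c : R[i]) (x y : ncpoly R) :
  bcum mu (s1 ++ (c *: x + y) :: s2) =
  c * bcum mu (s1 ++ x :: s2) + bcum mu (s1 ++ y :: s2).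
Proof.
have muE (t1 t2 : seq (ncpoly R)) :
    mu (\prod_(a <- t1 ++ (c *: x + y) :: t2) a) =
    c * mu (\prod_(a <- t1 ++ x :: t2) a) + mu (\prod_(a <- t1 ++ y :: t2) a).
  rewrite !big_cat !big_cons /= mulrDl mulrDr -scalerAl ncpoly_scaleAr.
  by rewrite linearP.
have [m] := ubnP (size s2); elim: m s2 => // m IH s2 sm.
rewrite !bcumE ?size_cat /= ?addnS // muE mulrBr addrACA -opprD; congr (_ - _).
rewrite mulr_sumr -big_split /=; apply: eq_big_nat => k /andP[k0 ks].
have [ks1|ks1] := leqP k (size s1).
  rewrite !takel_cat // !drop_cat; move: ks1; rewrite leq_eqVlt.
  case/orP => [/eqP -> | ks1]; rewrite ?ltnn ?ks1 ?subnn ?drop0.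
    by rewrite (muE [::]) mulrDr mulrCA.
  by rewrite muE mulrDr mulrCA.
have [j Ek] : exists j, k = (size s1 + j.+1)%N.
  by exists (k - (size s1).+1)%N; move: ks1; lia.
rewrite Ek !take_cat !drop_cat !ltnNge !leq_addr !addKn /=.
by rewrite IH ?mulrDl ?mulrA // size_takel; move: sm ks; rewrite Ek; lia.
Qed.

End Facts.

(* Functionals with the required properties exist. *)
Section Existence.

(* The lengths of the maximal runs of equal letters of a word. *)
Fixpoint runs (w : seq bool) : seq nat :=
  if w is x :: w' then
    if (w' != [::]) && (head x w' == x) then (head 0%N (runs w')).+1 :: behead (runs w')
    else 1%N :: runs w'
  else [::].

Fixpoint alt (c : bool) (s : seq nat) : seq bool :=
  if s is k :: s' then nseq k c ++ alt (~~ c) s' else [::].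

Lemma alt_head c x s : all (leq 1) s -> s != [::] -> head x (alt c s) = c.
Proof. by case: s => // -[|k] s. Qed.

Lemma alt_nil c s : all (leq 1) s -> (alt c s == [::]) = (s == [::]).
Proof. by case: s => // -[|k] s. Qed.

Lemma runs_alt c s : all (leq 1) s -> runs (alt c s) = s.
Proof.
elim: s c => //= k s IH c /andP[k0 s0]; case: k k0 => // k _.
have runsS (w : seq bool) : runs [:: c, c & w] =
    (head 0%N (runs (c :: w))).+1 :: behead (runs (c :: w)) by rewrite /= eqxx.
elim: k => [|k IHk]; last by rewrite [_ ++ _]/= runsS [runs (c :: _)]IHk.
rewrite /= IH // alt_nil //; case: eqP => //= /eqP sn.
by rewrite alt_head //; case: (c).
Qed.

Lemma mkseq_cons (T : Type) (f : nat -> T) n :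
  mkseq f n.+1 = f 0%N :: mkseq (fun m => f m.+1) n.
Proof. by rewrite /mkseq /= (iotaDl 1 0) -map_comp. Qed.

Lemma last_alt c x e n : (forall m, 0 < e m)%N ->
  last x (alt c (mkseq e n.+1)) = c (+) odd n.
Proof.
move=> e0; elim: n c x e e0 => [|n IH] c x e e0.
  rewrite /= cats0 addbF; case: (e 0%N) (e0 0%N) => // k _ /=.
  by elim: k => //.
rewrite mkseq_cons [alt _ _]/= last_cat IH //.
by rewrite /= addNb addbN.
Qed.

Variable R : realType.

Lemma prod_alt c (e : nat -> nat) n :
  \prod_(x <- mkseq (fun m => var R (c (+) odd m) ^+ e m) n) x
  = mon R (alt c (mkseq e n)).
Proof.
elim: n c e => [|n IH] c e; first by rewrite big_nil mon1.
rewrite !mkseq_cons big_cons [alt _ _]/= -monM -IH /= addbF varX.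
by under [in RHS]eq_mkseq do rewrite addNb -addbN.
Qed.

Lemma args_YXE k l p q : args_YX R k l p q =
  mkseq (fun m => var R (letterY (+) odd m) ^+ (if odd m then l else k) (p + m./2).+1)
    (2 * (q - p) - 1).
Proof. by apply: eq_mkseq => m; case: (odd m). Qed.

Lemma prod_args k l p q :
  \prod_(x <- args_YX R k l p q) x = mon R (alt letterY (args k l p q)).
Proof. by rewrite args_YXE prod_alt. Qed.

Lemma eq_args (T : Type) (a b a' b' : nat -> T) p q n : (q <= n)%N ->
  (forall i, (0 < i <= n)%N -> a i = a' i) ->
  (forall i, (0 < i < n)%N -> b i = b' i) ->
  args a b p q = args a' b' p q.
Proof.
move=> qn ea eb; apply/eq_in_map => m; rewrite mem_iota => /andP[_ mq].
by case: ifP => om; [apply: eb | apply: ea]; move: mq om; lia.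
Qed.

Definition run_Y (s : seq nat) (i : nat) : nat := nth 0%N s (2 * i.-1).
Definition run_X (s : seq nat) (i : nat) : nat := nth 0%N s (2 * i).-1.

Lemma run_YE k l n i : (0 < i <= n)%N -> run_Y (args k l 0 n) i = k i.
Proof.
move=> hi; rewrite /run_Y nth_mkseq; last by lia.
have -> : odd (2 * i.-1) = false by lia.
by congr k; lia.
Qed.

Lemma run_XE k l n i : (0 < i < n)%N -> run_X (args k l 0 n) i = l i.
Proof.
move=> hi; rewrite /run_X nth_mkseq; last by lia.
have -> : odd (2 * i).-1 = true by lia.
by congr l; lia.
Qed.

Variable mu : {scalar ncpoly R}.

Definition betaY_word (w : word) : R[i]^o :=
  if fmonom_val w is x :: w' then
    if (x == letterY) && (last x w' == letterY) then
      bcum mu (args_YX R (run_Y (runs w)) (run_X (runs w)) 0 (uphalf (size (runs w))))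
    else 0
  else 1.

Lemma args_gt0 (k l : nat -> nat) p q : (forall i, 0 < k i)%N ->
  (forall i, 0 < l i)%N -> all (leq 1) (args k l p q).
Proof.
by move=> k0 l0; apply/allP => x /mapP[m _ ->]; case: ifP.
Qed.

Lemma args_YX_runs k l n p q : (0 < n)%N -> (q <= n)%N -> (forall i, 0 < k i)%N ->
  (forall i, 0 < l i)%N ->
  args_YX R (run_Y (args k l 0 n)) (run_X (args k l 0 n)) p q = args_YX R k l p q.
Proof.
move=> n0 qn k0 l0; apply: (eq_args _ qn) => i hi; first by rewrite run_YE.
by rewrite run_XE.
Qed.

Lemma size_args (T : Type) (a b : nat -> T) n : (0 < n)%N ->
  uphalf (size (args a b 0 n)) = n.
Proof. by move=> n0; rewrite size_mkseq; lia. Qed.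

Lemma args_alt k l n : (0 < n)%N -> (forall i, 0 < k i)%N -> (forall i, 0 < l i)%N ->
  exists2 w, alt letterY (args k l 0 n) = letterY :: w & last letterY w = letterY.
Proof.
move=> n0 k0 l0; have := args_gt0 0 n k0 l0.
have: last letterY (alt letterY (args k l 0 n)) = letterY.
  rewrite /args; have -> : (2 * (n - 0) - 1 = (2 * n.-1).+1)%N by lia.
  by rewrite last_alt; [lia | move=> m; case: ifP].
have: args k l 0 n != [::] by rewrite -size_eq0 size_mkseq; lia.
case: (args k l 0 n) => [//|[|a] s] //= _ h _.
by exists (nseq a letterY ++ alt letterX s).
Qed.

Lemma block_cumulant_ex : exists betaY : {scalar ncpoly R}, is_block_cumulant mu betaY.
Proof.
exists (linext betaY_word : {scalar ncpoly R}).
have lE (w : seq bool) : linext betaY_word (mon R w) = betaY_word (FMonom w).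
  exact: linextU.
split.
- by rewrite -mon1; apply: etrans (lE _) _.
- move=> n k l n0 k0 l0; rewrite prod_args; apply: etrans (lE _) _; rewrite /betaY_word /=.
  have ra := runs_alt letterY (args_gt0 0 n k0 l0).
  rewrite ra size_args // args_YX_runs //.
  by have [w -> ->] := args_alt n0 k0 l0.
- by move=> w; apply: etrans (lE _) _.
- move=> w; apply: etrans (lE _) _; rewrite /betaY_word; case: w => [|x w] //=.
  by rewrite last_rcons andbF.
Qed.

Definition lead (w : seq bool) : nat := find (pred1 letterY) w.

Definition strip (w : seq bool) : seq bool :=
  take (size w - lead w - lead (rev w)) (drop (lead w) w).

Definition EX_word (w : word) : {poly R[i]} :=
  if letterY \in fmonom_val w then
    let s := runs (strip w) in
    'X^(lead w) * cond_exp_sum mu (uphalf (size s)) (run_Y s) (run_X s)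
      * 'X^(lead (rev w))
  else 'X^(size w).

Lemma lead_pad p q w : letterY \in w ->
  lead (nseq p letterX ++ w ++ nseq q letterX) = (p + lead w)%N.
Proof.
move=> Yw; rewrite /lead find_cat has_nseq andbF size_nseq find_cat.
by rewrite has_pred1 Yw.
Qed.

Lemma lead_rev_pad p q w : letterY \in w ->
  lead (rev (nseq p letterX ++ w ++ nseq q letterX)) = (q + lead (rev w))%N.
Proof. by move=> Yw; rewrite !rev_cat !rev_nseq -catA lead_pad // mem_rev. Qed.

Lemma strip_pad p q w : letterY \in w ->
  strip (nseq p letterX ++ w ++ nseq q letterX) = strip w.
Proof.
move=> Yw; rewrite /strip lead_pad // lead_rev_pad //.
have lw : (lead w < size w)%N by rewrite /lead -has_find has_pred1.
rewrite drop_cat size_nseq ltnNge leq_addr /= addKn drop_cat lw.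
rewrite !size_cat !size_nseq takel_cat; last by rewrite size_drop; lia.
by congr take; lia.
Qed.

Lemma EX_word_pad p q w :
  EX_word (FMonom (nseq p letterX ++ w ++ nseq q letterX)) =
  'X^p * EX_word (FMonom w) * 'X^q.
Proof.
rewrite /EX_word /= !mem_cat !mem_nseq !andbF orbF /=.
case: ifP => Yw; last by rewrite !size_cat !size_nseq !exprD mulrA.
rewrite lead_pad // lead_rev_pad // strip_pad // !exprD.
by rewrite -!mulrA; do 3! congr (_ * _); rewrite mulrC.
Qed.

Lemma cond_exp_sum_runs k l n : (0 < n)%N -> (forall i, 0 < k i)%N ->
  (forall i, 0 < l i)%N ->
  cond_exp_sum mu n (run_Y (args k l 0 n)) (run_X (args k l 0 n))
  = cond_exp_sum mu n k l.
Proof.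
move=> n0 k0 l0; apply: eq_bigr => r _; apply: eq_bigr => i ipath /=.
congr (_ * _%:P).
  rewrite !big_seq; apply: eq_bigr => j ji; congr 'X^_; apply: run_XE.
  rewrite ltn_ord andbT; have /allP := order_path_min ltn_trans ipath.
  by apply; apply: map_f.
apply: eq_bigr => j _; congr bcum; apply: args_YX_runs => //=.
have [ji|ji] := ltnP j (size (map val i)); last by rewrite nth_default.
by have /mapP[x _ ->] := mem_nth n ji; apply: ltnW; apply: ltn_ord.
Qed.

Lemma EX_alt k l n : (0 < n)%N -> (forall i, 0 < k i)%N -> (forall i, 0 < l i)%N ->
  EX_word (FMonom (alt letterY (args k l 0 n))) = cond_exp_sum mu n k l.
Proof.
move=> n0 k0 l0; have [w wE wl] := args_alt n0 k0 l0.
have lE : lead (alt letterY (args k l 0 n)) = 0%N by rewrite wE.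
have rE : lead (rev (alt letterY (args k l 0 n))) = 0%N.
  by rewrite wE lastI rev_rcons wl.
rewrite /EX_word /= {1}wE inE /strip lE rE !subn0 drop0 take_size.
rewrite !expr0 mul1r mulr1 runs_alt ?args_gt0 // size_args //.
exact: cond_exp_sum_runs.
Qed.

Lemma EX_bimod (E : {linear ncpoly R -> {poly R[i]}}) :
  (forall w, E (mon R w) = EX_word (FMonom w)) ->
  forall b b' (P : ncpoly R), E (evalp letterX b * P * evalp letterX b') = b * E P * b'.
Proof.
move=> EE b b' P.
have polyE (p : {poly R[i]}) : p = \sum_(i < size p) p`_i *: 'X^i.
  by rewrite -[LHS]coefK poly_def.
have EZ c (Q : ncpoly R) : E (c *: Q) = c *: E Q by rewrite linearZ.
have stepl (A : ncpoly R) : E (evalp letterX b * A)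
    = \sum_(i < size b) b`_i *: E (var R letterX ^+ i * A).
  rewrite /evalp mulr_suml linear_sum; apply: eq_bigr => i _.
  by rewrite -scalerAl linearZ.
have stepr (A : ncpoly R) : E (A * evalp letterX b')
    = \sum_(i < size b') b'`_i *: E (A * var R letterX ^+ i).
  rewrite /evalp mulr_sumr linear_sum; apply: eq_bigr => i _.
  by rewrite ncpoly_scaleAr linearZ.
have stepm (A B : ncpoly R) : E (A * (P * B)) = \sum_(w <- msupp P) P@_w *: E (A * (mon R w * B)).
  have fD : {morph (fun Q => E (A * (Q * B))) : Q1 Q2 / Q1 + Q2}.
    by move=> Q1 Q2; rewrite mulrDl mulrDr linearD.
  have f0 : E (A * (0 * B)) = 0 by rewrite mul0r mulr0 linear0.
  have fP := big_morph _ fD f0 (msupp P) xpredT (fun w => << P@_w *g w >>).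
  rewrite -(monalgE P) in fP.
  apply: (etrans fP); apply: eq_bigr => w _.
  have -> : << P@_w *g w >> = P@_w *: mon R w by rewrite monalg_scale /mon fmK.
  rewrite -[RHS]EZ.
  apply: (congr1 E).
  apply: etrans (ncpoly_scaleAr _ _ _).
  apply: (congr1 ( *%R A)).
  exact: ncpoly_scaleAl.
have -> : b * E P * b' = \sum_(i < size b) b`_i *: ('X^i * E P * b').
  rewrite {1}(polyE b) !mulr_suml; apply: eq_bigr => i _.
  by rewrite -!scalerAl.
rewrite -mulrA stepl; apply: eq_bigr => i _; congr (_ *: _).
rewrite stepm (malg_linE E P) mulr_sumr mulr_suml; apply: eq_bigr => w _.
rewrite -scalerAr -scalerAl; congr (_ *: _); rewrite [in LHS]mulrA stepr.
rewrite [in RHS](polyE b') mulr_sumr; apply: eq_bigr => j _.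
rewrite -scalerAr; congr (_ *: _).
by rewrite -mulrA !varX [mon R w * _]monM monM !EE EX_word_pad fmK.
Qed.

Lemma cond_exp_ex : exists EX : {linear ncpoly R -> {poly R[i]}}, is_cond_exp mu EX.
Proof.
exists (linext EX_word : {linear ncpoly R -> {poly R[i]}}).
have lE (w : seq bool) : linext EX_word (mon R w) = EX_word (FMonom w).
  exact: linextU.
split.
- by rewrite -mon1; apply: etrans (lE _) _.
- exact: EX_bimod.
- move=> n k l n0 k0 l0; rewrite prod_args; apply: etrans (lE _) _.
  exact: EX_alt.
Qed.

End Existence.

(* Main.v *)
(* By linearity it suffices to treat a word w. If w starts with X, only the cut
   in front of w survives, because beta_Y^b kills every other left factor; a
   trailing X factors out of both sides by the bimodule property. For
   w = a_1 b_1 ... b_(n-1) a_n, a cut contributes only when it is at the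
   beginning of some b_q, and the identity becomes
     E[w] = beta(a_1, ..., a_n)
            + sum_(1 <= q < n) beta(a_1, ..., a_q) b_q E[a_(q+1) ... a_n],
   which is the defining sum of E[w] sorted by its first index i_1 = q. *)
Require Import Defs.
From mathcomp Require Import all_boot all_order all_algebra.
From mathcomp Require Import complex reals.
From mathcomp Require Import zify boolp.
From mathcomp.multinomials Require Import monalg.

Set Implicit Arguments.
Unset Strict Implicit.
Unset Printing Implicit Defensive.

Import GRing.Theory.
Local Open Scope ring_scope.

(** * Sums over tuples, and shifted argument lists *)

Lemma sum_tupleS (V : nmodType) (T : finType) (r : nat) (P : pred (seq T))
    (F : seq T -> V) :
  \sum_(t : r.+1.-tuple T | P t) F t
  = \sum_(x : T) \sum_(t : r.-tuple T | P (x :: t)) F (x :: t).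
Proof.
rewrite pair_big_dep /=.
rewrite (reindex (fun y : T * r.-tuple T => [tuple of y.1 :: y.2])) //=.
exists (fun t : r.+1.-tuple T => (thead t, [tuple of behead t])).
  by move=> [x t] _ /=; rewrite theadE; congr (_, _); apply: val_inj.
by move=> t _; rewrite [RHS]tuple_eta.
Qed.

(** Discards the first [q] exponents, so that the tail of an alternating word is again described by
    blocks numbered from 1. *)
Definition shift (T : Type) (q : nat) (k : nat -> T) : nat -> T :=
  fun i => k (q + i)%N.

Lemma shift_add (T : Type) p q (k : nat -> T) : shift q (shift p k) = shift (p + q) k.
Proof. by apply: funext => i; rewrite /shift addnA. Qed.

Lemma args_shift (T : Type) (a b : nat -> T) m p q :
  args (shift m a) (shift m b) p q = args a b (m + p) (m + q).
Proof.
rewrite /args subnDl; apply: eq_mkseq => i.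
by case: ifP => _; rewrite /shift addnS addnA.
Qed.

Lemma args_YX_shift (R : realType) k l m p q :
  args_YX R (shift m k) (shift m l) p q = args_YX R k l (m + p) (m + q).
Proof. exact: args_shift. Qed.

Lemma argsS (T : Type) (a b : nat -> T) n : (0 < n)%N ->
  args a b 0 n.+1 = [:: a 1%N, b 1%N & args (shift 1 a) (shift 1 b) 0 n].
Proof.
move=> n0; rewrite /args; have -> : (2 * (n.+1 - 0) - 1 = (2 * (n - 0) - 1).+2)%N by lia.
rewrite !mkseq_cons; congr [:: _, _ & _]; apply: eq_mkseq => i /=.
by case: (odd i).
Qed.

(** * Words as alternating runs *)

Lemma word_alt (c : bool) (w : seq bool) :
  exists2 s, all (leq 1) s & c :: w = alt c s.
Proof.
elim: w c => [|x w IH] c; first by exists [:: 1%N].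
have [[//|[//|k] s] /= s0 ->] := IH x.
have [->|cx] := eqVneq c x; first by exists (k.+2 :: s).
have -> : x = ~~ c by case: c x cx => [] [].
by exists [:: 1%N, k.+1 & s].
Qed.

Lemma word_args (w : seq bool) : last letterY w = letterY ->
  exists n, exists k l : nat -> nat, [/\ (0 < n)%N, forall i, (0 < k i)%N,
    forall i, (0 < l i)%N & letterY :: w = alt letterY (args k l 0 n)].
Proof.
have [s s0 ws] := word_alt letterY w => wl.
(* The default 1 keeps the exponents positive beyond the end of [s] too. *)
have n0 i : (0 < nth 1%N s i)%N.
  have [si|si] := ltnP i (size s); last by rewrite nth_default.
  by apply: (allP s0); apply: mem_nth.
have sE : s = mkseq (nth 1%N s) (size s) by rewrite mkseq_nth.
have sz : (0 < size s)%N by case: s ws {s0 n0 sE}.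
(* The runs alternate starting from Y, so ending in Y forces an odd number of them. *)
have os : odd (size s).
  have := last_alt letterY letterY (size s).-1 n0.
  by rewrite prednK // -sE -ws /= wl; lia.
exists (uphalf (size s)), (fun i => nth 1%N s (2 * i.-1)%N), (fun i => nth 1%N s (2 * i).-1).
split=> //; first by lia.
rewrite ws; congr alt; rewrite {1}sE /args.
have <- : size s = (2 * (uphalf (size s) - 0) - 1)%N by lia.
by apply: eq_mkseq => m; rewrite add0n; case: ifP => om; congr nth; lia.
Qed.

(** * Recursion for the sum defining the conditional expectation *)

Section CondExp.
Variable R : realType.
Variable mu : {scalar ncpoly R}.

Section PartialSum.
Variables (n : nat) (k l : nat -> nat).

(** The summand of [cond_exp_sum] with $i_0 = p$ in place of 0, so that removing the first index
    gives a term of the same kind. *)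
Definition cond_exp_term (p : nat) (s : seq 'I_n) : {poly R[i]} :=
  let idx := nth n (p :: map val s) in
  (\prod_(j <- s) 'X^(l j))
  * (\prod_(j < (size s).+1) bcum mu (args_YX R k l (idx j) (idx j.+1)))%:P.

(** The bound [N] on the number of indices is kept apart from [n]: it drops with each removed index,
    while the endpoint [n] stays. *)
Definition cond_exp_sum_from (N p : nat) : {poly R[i]} :=
  \sum_(r < N) \sum_(t : r.-tuple 'I_n | path ltn p (map val t)) cond_exp_term p t.

Lemma cond_exp_term_cons p q s : cond_exp_term p (q :: s) =
  'X^(l q) * (bcum mu (args_YX R k l p q))%:P * cond_exp_term q s.
Proof.
rewrite /cond_exp_term big_cons big_ord_recl /= polyCM.
by rewrite !mulrA; congr (_ * _); rewrite -!mulrA; congr (_ * _); rewrite mulrC.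
Qed.

(** The empty tuple gives the single cumulant; the other tuples are grouped by their first index
    [q]. *)
Lemma cond_exp_sum_fromS N p : cond_exp_sum_from N.+1 p =
  (bcum mu (args_YX R k l p n))%:P + \sum_(p.+1 <= q < n)
    'X^(l q) * (bcum mu (args_YX R k l p q))%:P * cond_exp_sum_from N q.
Proof.
rewrite /cond_exp_sum_from big_ord_recl; congr (_ + _).
  rewrite (big_pred1 [tuple]); last by move=> t; rewrite /= tuple0 /= eqxx.
  by rewrite /cond_exp_term big_nil mul1r /= big_ord_recl big_ord0 mulr1.
under eq_bigr => r _ do
  rewrite (sum_tupleS _ (fun t => path ltn p (map val t)) (cond_exp_term p)) /=.
rewrite exchange_big big_geq_mkord /= [RHS]big_mkcond; apply: eq_bigr => q _.
case: ifP => pq; last by rewrite big1 // => r _; rewrite big_pred0.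
rewrite mulr_sumr; apply: eq_bigr => r _; rewrite mulr_sumr.
by apply: eq_bigr => t _; rewrite cond_exp_term_cons.
Qed.

End PartialSum.

Lemma cond_exp_sumE n k l : cond_exp_sum mu n k l = cond_exp_sum_from n k l n 0.
Proof.
apply: eq_bigr => r _; apply: eq_bigr => t _.
by rewrite /cond_exp_term size_tuple.
Qed.

(* The cut-off N on the number of indices is harmless as soon as it is at
   least n - p, since the indices increase strictly between p and n. *)
Lemma cond_exp_sum_from_shift N n p k l : (p < n)%N -> (n - p <= N)%N ->
  cond_exp_sum_from n k l N p = cond_exp_sum mu (n - p) (shift p k) (shift p l).
Proof.
(* Removing an index leaves cut-off [N] on the left but possibly a smaller one on the right, hence
   strong induction. *)
elim/ltn_ind: N n p k l => -[|N] IH n p k l pn nN; first by lia.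
rewrite cond_exp_sumE.
have [m Em] : exists m, (n - p = m.+1)%N by exists (n - p).-1; lia.
rewrite [in RHS]Em !cond_exp_sum_fromS -Em args_YX_shift addn0 subnKC 1?ltnW //.
congr (_ + _); rewrite (big_addn 0 n p.+1) (big_addn 0 _ 1) -subnDA addn1.
apply: eq_big_nat => q /= qn; rewrite args_YX_shift addn0.
have -> : (q + p.+1 = p + q.+1)%N by lia.
rewrite IH // 1?[in RHS]IH ?addn1; try lia.
by rewrite !shift_add subnDA.
Qed.

Lemma cond_exp_sum_rec n k l : (0 < n)%N -> cond_exp_sum mu n k l =
  (bcum mu (args_YX R k l 0 n))%:P + \sum_(1 <= q < n)
    bcum mu (args_YX R k l 0 q) *:
      ('X^(l q) * cond_exp_sum mu (n - q) (shift q k) (shift q l)).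
Proof.
case: n => // n _; rewrite cond_exp_sumE cond_exp_sum_fromS; congr (_ + _).
(* As [q] is at least 1, the remaining cut-off [n] still bounds [n.+1 - q]. *)
apply: eq_big_nat => q qn; rewrite cond_exp_sum_from_shift; try lia.
by rewrite -mul_polyC mulrCA mulrA.
Qed.

(** * The sum over cuts, and the identity on words *)

Section Recursion.
Variables (betaY : {scalar ncpoly R}) (EX : {linear ncpoly R -> {poly R[i]}}).
Hypothesis betaYP : is_block_cumulant mu betaY.
Hypothesis EXP : is_cond_exp mu EX.

Lemma evalpXn c n : evalp c ('X^n : {poly R[i]}) = var R c ^+ n.
Proof.
rewrite /evalp size_polyXn big_ord_recr /= big1 ?add0r; last first.
  by move=> i _; rewrite coefXn ltn_eqF // scale0r.
by rewrite coefXn eqxx scale1r.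
Qed.

Lemma EX_pad p q w :
  EX (mon R (nseq p letterX ++ w ++ nseq q letterX))
  = 'X^p * EX (mon R w) * 'X^q.
Proof. by rewrite -(cond_exp_bimod EXP) !evalpXn !varX !monM catA. Qed.

Lemma EX_nseq_cat p w :
  EX (mon R (nseq p letterX ++ w)) = 'X^p * EX (mon R w).
Proof. by rewrite -[w in LHS]cats0 (EX_pad p 0) mulr1. Qed.

Lemma EX_rcons w : EX (mon R (rcons w letterX)) = EX (mon R w) * 'X.
Proof. by rewrite -cats1 (EX_pad 0 1) mul1r. Qed.

(* (beta_Y^b (x) E_X) applied to the word [w] split at its letters X, with
   [u] prepended to the left factor. *)
Definition delta_sum (u w : seq bool) : {poly R[i]} :=
  \sum_(j < size w | nth letterY w j == letterX)
    betaY (mon R (u ++ take j w)) *: EX (mon R (drop j w)).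

Lemma delta_sum_nil u : delta_sum u [::] = 0.
Proof. by rewrite /delta_sum big_ord0. Qed.

Lemma delta_sum_cons u c w : delta_sum u (c :: w) =
  (if c == letterX then betaY (mon R u) *: EX (mon R (c :: w)) else 0)
  + delta_sum (rcons u c) w.
Proof.
rewrite /delta_sum big_mkcond big_ord_recl /= cats0; congr (_ + _).
by rewrite -big_mkcond /=; under [RHS]eq_bigr => j _ do rewrite cat_rcons.
Qed.

Lemma delta_sum_catY u k w :
  delta_sum u (nseq k letterY ++ w) = delta_sum (u ++ nseq k letterY) w.
Proof.
elim: k u => [|k IH] u; first by rewrite cats0.
by rewrite delta_sum_cons add0r IH cat_rcons.
Qed.

(* Only the cut at the beginning of a run of X contributes. *)
Lemma delta_sum_catX u l w : (0 < l)%N ->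
  delta_sum u (nseq l letterX ++ w) =
  betaY (mon R u) *: EX (mon R (nseq l letterX ++ w))
  + delta_sum (u ++ nseq l letterX) w.
Proof.
case: l => // l _; rewrite delta_sum_cons eqxx; congr (_ + _).
rewrite -cat_rcons; elim: l u => [|l IH] u; first by rewrite cats0.
by rewrite delta_sum_cons (block_cumulantXr betaYP) scale0r add0r IH cat_rcons.
Qed.

Lemma delta_sum_Xl u w :
  delta_sum (letterX :: u) w = 0.
Proof.
by apply: big1 => j _; rewrite (block_cumulantXl betaYP) scale0r.
Qed.

(** At the old cuts the last X leaves the right factor by the bimodule property; the new cut, in
    front of that X, gives the second term. *)
Lemma delta_sum_rconsX w : delta_sum [::] (rcons w letterX) =
  delta_sum [::] w * 'X + betaY (mon R w) *: 'X.
Proof.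
rewrite /delta_sum size_rcons big_mkcond big_ord_recr /=; congr (_ + _).
  rewrite -big_mkcond mulr_suml; apply: eq_big => j /=.
    by rewrite nth_rcons ltn_ord.
  move=> _; rewrite -cats1 takel_cat; last exact: ltnW.
  by rewrite drop_cat ltn_ord cats1 EX_rcons scalerAl.
rewrite nth_rcons ltnn eqxx -cats1 take_size_cat // drop_size_cat //.
by rewrite -[[:: _]]/(rcons [::] letterX) EX_rcons mon1 (cond_exp1 EXP) mul1r.
Qed.

(** Induction on the number of blocks: a run of Y moves into the prefix [u], and a run of X yields
    one term before doing so. *)
Lemma delta_sum_alt u n k l : (0 < n)%N -> (forall i, 0 < l i)%N ->
  delta_sum u (alt letterY (args k l 0 n)) =
  \sum_(1 <= q < n) betaY (mon R (u ++ alt letterY (args k l 0 q))) *: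
    EX (mon R (nseq (l q) letterX ++
      alt letterY (args (shift q k) (shift q l) 0 (n - q)))).
Proof.
elim: n u k l => // -[|n] IH u k l _ l0.
  by rewrite big_geq // delta_sum_catY delta_sum_nil.
rewrite argsS // big_ltn // [alt _ _]/= delta_sum_catY delta_sum_catX //.
rewrite subSS subn0; congr (_ *: EX (mon R _) + _); first by rewrite /= cats0.
rewrite IH //; last by move=> i; apply: l0.
rewrite big_add1; apply: eq_big_nat => q /andP[q0 qn].
by rewrite argsS //= !shift_add -!catA subSS.
Qed.

Lemma EX_alt_rec n k l : (0 < n)%N -> (forall i, 0 < k i)%N ->
  (forall i, 0 < l i)%N ->
  let w := alt letterY (args k l 0 n) in
  EX (mon R w) = (betaY (mon R w))%:P + delta_sum [::] w.
Proof.
move=> n0 k0 l0 /=; rewrite delta_sum_alt //.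
have EXE m k' l' : (0 < m)%N -> (forall i, 0 < k' i)%N -> (forall i, 0 < l' i)%N ->
    EX (mon R (alt letterY (args k' l' 0 m))) = cond_exp_sum mu m k' l'.
  by move=> *; rewrite -prod_args (cond_exp_alt EXP).
have betaE m : (0 < m)%N ->
    betaY (mon R (alt letterY (args k l 0 m))) = bcum mu (args_YX R k l 0 m).
  by move=> *; rewrite -prod_args (block_cumulant_alt betaYP).
rewrite EXE // cond_exp_sum_rec // betaE //; congr (_ + _).
apply: eq_big_nat => q /andP[q0 qn].
by rewrite betaE // EX_nseq_cat EXE // /shift ?subn_gt0.
Qed.

Lemma EX_word_rec w : EX (mon R w) = (betaY (mon R w))%:P + delta_sum [::] w.
Proof.
elim/last_ind: w => [|w [] IH].
- by rewrite delta_sum_nil addr0 mon1 (cond_exp1 EXP) (block_cumulant1 betaYP).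
- case: w {IH} => [|[] w].
  + exact: (@EX_alt_rec 1 (fun=> 1%N) (fun=> 1%N)).
  + have [|n [k [l [n0 k0 l0 wE]]]] := @word_args (rcons w letterY).
      by rewrite last_rcons.
    by rewrite rcons_cons wE; apply: EX_alt_rec.
  + rewrite rcons_cons delta_sum_cons delta_sum_Xl addr0 /=.
    (* Only the empty left factor survives, with weight 1. *)
    by rewrite (block_cumulantXl betaYP) mon1 (block_cumulant1 betaYP) scale1r add0r.
(* The constant term for [w], multiplied by ['X], becomes the cut before the final X. *)
- rewrite EX_rcons IH delta_sum_rconsX (block_cumulantXr betaYP) add0r mulrDl.
  by rewrite addrC mul_polyC.
Qed.

End Recursion.
End CondExp.

Theorem theorem1p2 (R : realType) (mu : {scalar ncpoly R})
    (mu_unital : mu 1 = 1) (mu_free : free_XY mu)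
    (betaY : {scalar ncpoly R}) (betaY_block : is_block_cumulant mu betaY)
    (EX : {linear ncpoly R -> {poly R[i]}}) (EX_cond : is_cond_exp mu EX)
    (P : ncpoly R) :
  EX P = (betaY P)%:P + tensor_map betaY EX (delta_X P).
Proof.
rewrite (malg_linE EX) (malg_linE betaY) /delta_X /tensor_map {2}/linext.
rewrite linear_sum rmorph_sum -big_split /=; apply: eq_bigr => w _.
rewrite (EX_word_rec betaY_block EX_cond) linearZ /= scalerDr polyCM mul_polyC.
(* On a single word, [tensor_mapE] turns each cut into a term of [delta_sum]. *)
congr (_ + _ *: _); rewrite linear_sum; apply: eq_bigr => j _.
exact/esym/tensor_mapE.
Qed.
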